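(* Let $G$ be a finite, simple, undirected graph. Then $G$ is $(Z_+, Z)$-perfect (that is, $Z_+(H) = Z(H)$ for every induced subgraph $H$ of $G$) if and only if $G$ is claw-free.
   Context: All graphs are finite, simple and undirected. A graph is claw-free if it has no induced subgraph isomorphic to $K_{1,3}$. Forcing process: the vertex set is partitioned as $V(G) = B \cup W$ into blue vertices $B$ and white vertices $W$. A color change rule specifies when a blue vertex $u \in B$ may force a white vertex $v \in W$ to become blue. At each time step some set of valid forces (with respect to the current coloring) is performed, no white vertex being forced by more than one vertex, and the forced vertices are moved from $W$ to $B$. This is repeated until no further color changes are possible. If all vertices of $G$ are then blue, the initial set $B$ is called a forcing set of $G$ under the given rule. Standard forcing rule: a blue vertex $u$ may force a white vertex $v$ if $v$ is the only white neighbor of $u$ in $G$. $Z(G)$, the standard forcing number, is the minimum cardinality of a forcing set under this rule. Positive semidefinite forcing rule: a blue vertex $u$ may force a white vertex $v$ if $v$ is the only neighbor of $u$ in the connected component of the induced subgraph $G[W]$ that contains $v$, where $W$ is the current set of white vertices. $Z_+(G)$, the positive semidefinite forcing number, is the minimum cardinality of a forcing set under this rule. A graph $G$ is $(Z_+, Z)$-perfect if $Z_+(H) = Z(H)$ for every induced subgraph $H$ of $G$. *)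

(* Defs.v *)
From HB Require Import structures.
From mathcomp Require Import all_boot.

Set Implicit Arguments.
Unset Strict Implicit.
Unset Printing Implicit Defensive.

Record sgraph := SGraph {
  vertex :> finType;
  adj : rel vertex;
  adj_sym : symmetric adj;
  adj_irrefl : irreflexive adj }.

Section Induced.
Variables (G : sgraph) (S : {set G}).

Definition induced_adj : rel {x : G | x \in S} :=
  fun x y => adj (val x) (val y).

Lemma induced_adj_sym : symmetric induced_adj.
Proof. by move=> x y; apply: adj_sym. Qed.

Lemma induced_adj_irrefl : irreflexive induced_adj.
Proof. by move=> x; apply: adj_irrefl. Qed.

Definition induced : sgraph := SGraph induced_adj_sym induced_adj_irrefl.
End Induced.

Section CompleteBipartite.
Variables m n : nat.

Definition biclique_adj : rel ('I_m + 'I_n)%type := fun x y =>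
  match x, y with
  | inl _, inr _ | inr _, inl _ => true
  | _, _ => false
  end.

Lemma biclique_adj_sym : symmetric biclique_adj.
Proof. by case=> i [] j. Qed.

Lemma biclique_adj_irrefl : irreflexive biclique_adj.
Proof. by case. Qed.

Definition complete_bipartite : sgraph :=
  SGraph biclique_adj_sym biclique_adj_irrefl.
End CompleteBipartite.

Definition isomorphic (G H : sgraph) : Prop :=
  exists2 f : G -> H, bijective f & forall x y, adj (f x) (f y) = adj x y.

Definition claw_free (G : sgraph) : Prop :=
  forall S : {set G}, ~ isomorphic (induced S) (complete_bipartite 1 3).

(* A colouring is represented by its set B of blue vertices; the white ones
   are ~: B.  A rule is only ever consulted, by [valid_force], for a blue u
   and a white v. *)
Definition forcing_rule (G : sgraph) := {set G} -> rel G.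

Definition standard_rule (G : sgraph) : forcing_rule G := fun B u v =>
  [set w in ~: B | adj u w] == [set v].

(* The vertex set, in G, of the component of G[W] containing v, for v \in W. *)
Definition component (G : sgraph) (W : {set G}) (v : G) : {set G} :=
  [set w | connect [rel x y | [&& x \in W, y \in W & adj x y]] v w].

Definition psd_rule (G : sgraph) : forcing_rule G := fun B u v =>
  [set w in component (~: B) v | adj u w] == [set v].

Section Forcing.
Variables (G : sgraph) (rule : forcing_rule G).

Definition valid_force (B : {set G}) (u v : G) : bool :=
  [&& u \in B, v \notin B & rule B u v].

(* One time step turns the colouring B into C by performing a set F of forces
   (u, v), where no v is forced twice; one u may force several vertices. *)
Definition forcing_step : rel {set G} := fun B C =>
  [exists F : {set G * G},
    [&& [forall f in F, valid_force B f.1 f.2],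
        dinjectiveb snd F
      & C == B :|: [set f.2 | f in F]]].

(* The all-blue colouring admits no further force, so a run that reaches it
   has ended.  Under both rules above a valid force stays valid, as long as its
   target is white, when more vertices become blue; the final colouring thus
   does not depend on the forces chosen. *)
Definition forcing_set (B : {set G}) : bool :=
  connect forcing_step B [set: G].

Definition forcing_number : nat :=
  #|[arg min_(B < [set: G] | forcing_set B) #|B|]|.
End Forcing.

Definition Z (G : sgraph) : nat := forcing_number (@standard_rule G).

Definition Zplus (G : sgraph) : nat := forcing_number (@psd_rule G).

Definition perfect (p q : sgraph -> nat) (G : sgraph) : Prop :=
  forall S : {set G}, p (induced S) = q (induced S).

(* Main.v *)
(** A component W of the white graph always has a vertex u outside it with
    exactly one neighbour v in W, because some vertex of W is the first one to
    be forced by the positive semidefinite rule.  Run the standard rule from B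
    until it reaches S.  If u has no white neighbour besides v, the standard
    run continues.  Otherwise u sees two white components.  A blue vertex
    without white neighbours cannot be adjacent to u, since the two would form
    a claw with a neighbour of u in each component; as every vertex that has
    forced is of this kind, u lies in B and plays no role in the run, and
    replacing u by v in B and in S gives another run with sets of the same
    sizes.  The white component W loses v (or, if W = {v}, v can now force u),
    so iterating makes the run progress. *)

Require Import Defs.
From mathcomp Require Import all_boot.
From mathcomp Require Import zify.

Set Implicit Arguments.
Unset Strict Implicit.
Unset Printing Implicit Defensive.

(** * Forcing sets and runs under an arbitrary rule *)

Section ForcingNumber.
Variables (G : sgraph) (rule : forcing_rule G).

Lemma forcing_number_le (B : {set G}) :
  forcing_set rule B -> forcing_number rule <= #|B|.
Proof.
rewrite /forcing_number; case: arg_minnP => [|A _ minA]; last exact: minA.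
exact: connect0.
Qed.

Lemma forcing_number_witness :
  exists2 B : {set G}, forcing_set rule B & #|B| = forcing_number rule.
Proof.
rewrite /forcing_number; case: arg_minnP => [|A fA _]; last by exists A.
exact: connect0.
Qed.

Lemma forcing_step1 (S : {set G}) u v :
  valid_force rule S u v -> forcing_step rule S (v |: S).
Proof.
move=> uv; apply/existsP; exists [set (u, v)]; apply/and3P; split.
- by apply/forallP=> f; apply/implyP=> /set1P->.
- by apply/dinjectiveP=> f g /set1P-> /set1P->.
- by rewrite imset_set1 setUC.
Qed.

(** Take the colouring just before the run first meets [W]: the next step contains a force into [W]
    that is valid for this colouring. *)
Lemma forced_into (B W : {set G}) :
    forcing_set rule B -> W != set0 -> [disjoint B & W] ->
  exists (X : {set G}) (u v : G), [/\ [disjoint X & W], v \in W & valid_force rule X u v].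
Proof.
move=> /connectP[p]; elim: p B => [|C p IHp] B /=.
  move=> _ <- /set0Pn[x xW] /pred0P/(_ x) /=; by rewrite in_setT xW.
move=> /andP[/existsP[F /and3P[/forallP vF _ /eqP defC]] pC lastC] W0 dBW.
have [dCW|] := boolP [disjoint C & W]; first exact: IHp dCW.
case/pred0Pn=> v /=; rewrite defC in_setU.
case/andP=> /orP[vB vW|/imsetP[f fF ->] vW].
  by move/pred0P: dBW => /(_ v) /=; rewrite vB vW.
by exists B, f.1, f.2; split=> //; have /implyP := vF f; apply.
Qed.

(** Single forces are appended at the end of a run with fixed start [B], so that induction can alter
    the run force by force. *)
Inductive forces_to (B : {set G}) : {set G} -> Prop :=
| Forces0 : forces_to B B
| ForcesS S u v : forces_to B S -> valid_force rule S u v ->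
    forces_to B (v |: S).

Lemma forces_to_sub B S : forces_to B S -> B \subset S.
Proof. by elim=> // {}S u v _ BS _; apply: subset_trans BS (subsetUr _ _). Qed.

Lemma forces_to_connect B S : forces_to B S -> connect (forcing_step rule) B S.
Proof.
elim=> [|{}S u v _ BS uv]; first exact: connect0.
exact/(connect_trans BS)/connect1/forcing_step1/uv.
Qed.

End ForcingNumber.

(** * Claws, connected sets and components *)

Section Graph.
Variable G : sgraph.
Implicit Types (S B W : {set G}) (u v w : G).

Definition has_claw := exists u a b c : G,
  [/\ [/\ adj u a, adj u b & adj u c], uniq [:: a; b; c]
    & [/\ ~~ adj a b, ~~ adj a c & ~~ adj b c]].

Lemma claw_free_no_claw : claw_free G -> ~ has_claw.
Proof.
move=> cfG [u [a [b [c [[ua ub uc] /=]]]]].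
rewrite !inE negb_or !andbT => /andP[/andP[ab ac] bc] [nab nac nbc].
have neq (x y : G) : adj x y -> x == y = false.
  by move=> xy; apply/negbTE/eqP=> eq_xy; rewrite eq_xy adj_irrefl in xy.
have [ua' ub' uc'] := And3 (neq _ _ ua) (neq _ _ ub) (neq _ _ uc).
pose S := [set u; a; b; c].
(* [f] matters only on [S], where the last branch means [c]. *)
pose f (x : G) : 'I_1 + 'I_3 := if x == u then inl ord0 else
  if x == a then inr ord0 else if x == b then inr (inord 1) else inr ord_max.
have [fu fa fb fc] : [/\ f u = inl ord0, f a = inr ord0,
    f b = inr (inord 1) & f c = inr ord_max].
  by rewrite /f !eqxx ![_ == u]eq_sym ua' ub' uc' [b == a]eq_sym ![c == _]eq_sym
    (negbTE ab) (negbTE ac) (negbTE bc).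
have inS (x : G) : x \in S -> [\/ x = u, x = a, x = b | x = c].
  by rewrite !inE -!orbA => /or4P[] /eqP->; [constructor 1|constructor 2|constructor 3|
    constructor 4].
have neq01 : inord 1 == ord0 :> 'I_3 = false by rewrite -val_eqE /= inordK.
have neq12 : inord 1 == ord_max :> 'I_3 = false by rewrite -val_eqE /= inordK.
have injf : injective (fun x : induced S => f (val x)).
  move=> [x xS] [y yS] /= fxy; apply: val_inj => /=; move: fxy.
  case: (inS x xS) => ->; case: (inS y yS) => ->; rewrite ?(fu, fa, fb, fc) //.
  - by case=> /eqP; rewrite eq_sym neq01.
  - by case=> /eqP; rewrite neq01.
  - by case=> /eqP; rewrite neq12.
  - by case=> /eqP; rewrite eq_sym neq12.
apply: (cfG S); exists (fun x => f (val x)).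
  apply: inj_card_bij injf _.
  rewrite card_sum !card_ord card_sig (eq_card (_ : _ =i S)) //.
  by rewrite /S -!setUA !cardsU1 !inE !negb_or cards1 ua' ub' uc' ab ac bc.
move=> [x xS] [y yS]; rewrite /= /induced_adj /=.
case: (inS x xS) => ->; case: (inS y yS) => ->; rewrite ?(fu, fa, fb, fc) /=;
  by rewrite ?adj_irrefl ?ua ?ub ?uc // adj_sym ?ua ?ub ?uc //;
    apply/esym/negbTE=> //; rewrite adj_sym.
Qed.

(** Connectedness by closed subsets instead of paths; the empty set satisfies it, so non-emptiness
    is a separate hypothesis later. *)
Definition connected W := forall A : {set G}, A \subset W -> A != set0 ->
  (forall x y, x \in A -> y \in W -> adj x y -> y \in A) -> W \subset A.

Lemma component_connect S x y z : y \in component S x ->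
  (z \in component S x) = (z \in component S y).
Proof.
rewrite !inE => xy; apply: (same_connect _ xy).
by apply: sym_connect_sym => a b /=; rewrite adj_sym andbCA.
Qed.

Lemma component_self S x : x \in component S x.
Proof. by rewrite inE connect0. Qed.

Lemma component_closed S x y z :
  y \in component S x -> y \in S -> z \in S -> adj y z -> z \in component S x.
Proof.
rewrite !inE => xy yS zS yz; apply: connect_trans xy (connect1 _) => /=.
by rewrite yS zS.
Qed.

Lemma component_min S x (A : {set G}) :
    x \in A -> (forall y z, y \in A -> z \in S -> adj y z -> z \in A) ->
  component S x \subset A.
Proof.
move=> xA clA; apply/subsetP=> z; rewrite inE => /connectP[p].
elim: p x xA => [|y p IHp] x xA /= => [_ -> //|/andP[/and3P[_ yS xy] py]].
exact/IHp/py/(clA x).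
Qed.

Lemma component_sub S x : x \in S -> component S x \subset S.
Proof. by move=> xS; apply: component_min. Qed.

(** A component is the same from each of its vertices, so it may be based at a vertex of [A], and
    minimality places it inside [A]. *)
Lemma component_connected S x : x \in S -> connected (component S x).
Proof.
move=> xS A AC /set0Pn[a aA] clA; have aC := subsetP AC a aA.
apply/subsetP=> z; rewrite (component_connect _ aC); apply/subsetP.
apply: component_min => // y z' yA z'S yz'; apply: (clA y) => //.
have yC := subsetP AC y yA.
exact: component_closed yC (subsetP (component_sub xS) y yC) z'S yz'.
Qed.

Lemma connected_component S W v :
  connected W -> W \subset S -> v \in W -> W \subset component S v.
Proof.
move=> cW WS vW; apply: subset_trans (subsetIr W _); apply: cW.
- exact: subsetIl.
- by apply/set0Pn; exists v; rewrite inE vW component_self.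
move=> x y /setIP[xW xC] yW xy; rewrite inE yW.
by apply: component_closed xC _ _ xy; apply: (subsetP WS).
Qed.

(** * The invariant extracted from positive semidefinite forcing *)

(** Quantifying over all connected white sets, not only components, makes the property monotone in
    [S]; [u] need not be blue. *)
Definition psd_closing S := forall W, connected W -> W != set0 ->
  [disjoint S & W] ->
  exists u v, [/\ u \notin W, v \in W & [set w in W | adj u w] = [set v]].

(** The first force into [W] supplies [u] and [v]: at that moment [W] is white and connected, hence
    inside the component of [v]. *)
Lemma forcing_set_psd_closing B :
  forcing_set (@psd_rule G) B -> psd_closing B.
Proof.
move=> fB W cW W0 dBW.
have [X [u [v [dXW vW /and3P[uX _ /eqP uv]]]]] := forced_into fB W0 dBW.
exists u, v; split=> //; first by rewrite (disjointFr dXW uX).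
have WX : W \subset ~: X by rewrite -disjoints_subset disjoint_sym.
have WC := connected_component cW WX vW.
apply/setP=> w; apply/idP/idP; rewrite inE.
  by case/andP=> /(subsetP WC) wC uw; rewrite -uv inE wC.
by move/eqP->; rewrite inE vW; have := set11 v; rewrite -{1}uv inE => /andP[].
Qed.

Lemma psd_closing_sub S S' : S \subset S' -> psd_closing S -> psd_closing S'.
Proof.
move=> SS' clS W cW W0 dSW; apply: clS => //.
exact: disjointWl dSW.
Qed.

(** * Standard runs and the exchange of a blue vertex for a white one *)

Lemma standard_ruleP S u v : valid_force (@standard_rule G) S u v <->
  [/\ u \in S, v \notin S, adj u v & forall w, adj u w -> w \in v |: S].
Proof.
rewrite /valid_force; split=> [/and3P[uS vS /eqP uv]|[uS vS uv sub]].
  split=> // [|w uw]; first by have := set11 v; rewrite -uv inE => /andP[].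
  rewrite in_setU1; case: (boolP (w \in S)) => [|wS]; first by rewrite orbT.
  by rewrite orbF -in_set1 -uv !inE wS.
rewrite uS vS; apply/eqP/setP=> w; rewrite !inE.
apply/andP/eqP=> [[wS /sub]|->//]; by rewrite !inE (negbTE wS) orbF => /eqP.
Qed.

(* [S] bounds the run, while the induction is on its intermediate stages. *)
Lemma forces_to_swap B R S u v :
    (forall p, p \in S -> (forall w, adj p w -> w \in S) -> ~~ adj p u) ->
    adj u v -> v \notin S ->
    forces_to (@standard_rule G) B R -> R \subset S -> u \in R ->
  u \in B /\ forces_to (@standard_rule G) (v |: B :\ u) (v |: R :\ u).
Proof.
move=> nadj uv vS; elim=> [_ uB|{}R p q _ IH pq qRS]; first by split=> //; constructor.
have /standard_ruleP[pR qR adj_pq sub] := pq.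
have subS w : adj p w -> w \in S by move=> /sub/(subsetP qRS).
have pS := subsetP qRS p (setU1r q pR).
(* A vertex [p] that forces in this run has all its neighbours in [S], so it is not adjacent to [u]:
   [u] is never forced, and turning it white hinders no force. *)
have pu := nadj p pS subS; have qu : q != u by apply: contraNneq pu => <-.
rewrite in_setU1 eq_sym (negbTE qu) => /= uR.
have [uB fR] := IH (subset_trans (subsetUr _ _) qRS) uR; split=> //.
have qv : q != v by apply: contraNneq vS => <-; apply: subS.
have -> : v |: (q |: R) :\ u = q |: (v |: R :\ u).
  by rewrite setUCA; congr (_ |: _); apply/setP=> w; rewrite !inE;
    case: (w =P q) => // ->; rewrite qu.
apply: (ForcesS (u := p) fR); apply/standard_ruleP; split.
- rewrite !inE pR andbT; apply/orP; right; apply: contraNneq vS => eq_pu.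
  by apply: subS; rewrite eq_pu.
- by rewrite !inE negb_or qv negb_and qR orbT.
- exact: adj_pq.
move=> w pw; have /setU1P[->|wR] := sub w pw; first exact: setU11.
by rewrite !inE wR andbT; apply/or3P/Or33; apply: contraNneq pu => <-.
Qed.

(** Only sets [X] containing [u] are new. Such an [X] cannot meet [W], since [u] touches [W] only in
    [v], which is now blue. Then [u] is the only neighbour of [v] in [X], as all other white
    neighbours of [v] lie in [W]. *)
Lemma psd_closing_swap S W u v :
    psd_closing S -> (forall x y, x \in W -> y \notin S -> adj x y -> y \in W) ->
    u \notin W -> v \in W -> [set w in W | adj u w] = [set v] ->
  psd_closing (v |: S :\ u).
Proof.
move=> clS clW uW vW uvW X cX X0 dX.
have uv : adj u v by have := set11 v; rewrite -uvW inE => /andP[].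
have vX : v \notin X by rewrite (disjointFr dX) ?setU11.
have XS x : x \in X -> x != u -> x \notin S.
  move=> xX xu; have := disjointFl dX xX.
  by rewrite !inE xu => /norP[_ ->].
have [uX|uX] := boolP (u \in X); last first.
  apply: clS => //; apply/pred0P=> x /=; apply/negP=> /andP[xS xX].
  have := XS x xX; rewrite xS.
  by case: eqP xX => [->|_ _ /(_ isT)//]; rewrite (negbTE uX).
have WX : W :&: X = set0.
  apply/eqP/negPn/negP=> WX0; have := cX (W :&: X) (subsetIr _ _) WX0.
  move=> /(_ _)/subsetP sub; suff : u \in W :&: X by rewrite inE (negbTE uW).
  apply: sub uX => x y /setIP[xW xX] yX xy; rewrite inE yX andbT.
  have [yu|yu] := eqVneq y u; last exact: clW xW (XS y yX yu) xy.
  suff : x \in [set v] by move/set1P=> xv; rewrite -xv xX in vX.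
  by rewrite -uvW inE xW adj_sym -yu.
exists v, u; split=> //; apply/setP=> x; rewrite !inE.
apply/andP/eqP=> [[xX vx]|->]; last by rewrite adj_sym.
apply/eqP; apply/negPn/negP=> xu; have xW := clW v x vW (XS x xX xu) vx.
by have := in_set0 x; rewrite -WX inE xW xX.
Qed.

(** The conditions on [W] make it a component of the white graph. Induction on [#|W|]: an exchange
    keeps [#|S|] and shrinks [W], until a force enlarges [S]. *)
Lemma forces_to_progress B S W :
    ~ has_claw -> forces_to (@standard_rule G) B S -> psd_closing S ->
    connected W -> W != set0 -> [disjoint S & W] ->
    (forall x y, x \in W -> y \notin S -> adj x y -> y \in W) ->
  exists B' S', [/\ #|B'| = #|B|, forces_to (@standard_rule G) B' S',
    psd_closing S' & #|S| < #|S'|].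
Proof.
move=> noclaw; have [m] := ubnP #|W|; elim: m => // m IHm in B S W *.
move=> leWm BS clS cW W0 dSW clW.
have [u [v [uW vW uvW]]] := clS W cW W0 dSW.
have uv : adj u v by have := set11 v; rewrite -uvW inE => /andP[].
have vS : v \notin S by rewrite (disjointFl dSW vW).
have uS : u \in S.
  by apply: contraNT uW => uS; apply: (clW v) => //; rewrite adj_sym.
have clvS : psd_closing (v |: S) := psd_closing_sub (subsetUr _ _) clS.
have ltvS : #|S| < #|v |: S| by rewrite cardsU1 vS.
have [/forallP sub|/forallPn[w]] := boolP [forall w, adj u w ==> (w \in v |: S)].
  exists B, (v |: S); split=> //.
  apply: (ForcesS (u := u) BS); apply/standard_ruleP.
  by split=> // w; apply/implyP/sub.
rewrite negb_imply in_setU1 negb_or => /and3P[uw wv wS].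
have wW : w \notin W.
  by apply: contraNN wv => wW; rewrite -in_set1 -uvW inE wW.
(* Such a [p] would complete a claw at [u] with the leaves [v] and [w], which lie in different white
   components. *)
have nadj p : p \in S -> (forall x, adj p x -> x \in S) -> ~~ adj p u.
  move=> pS subp; apply/negP=> pu; apply: noclaw; exists u, p, v, w.
  split; first by rewrite adj_sym.
    rewrite /= !inE negb_or [v == w]eq_sym wv !andbT.
    by apply/andP; split; apply: contraTneq pS => ->.
  split; [by apply: contraNN vS; apply: subp
         |by apply: contraNN wS; apply: subp|].
  by apply: contraNN wW; apply: clW.
have [uB] := forces_to_swap nadj uv vS BS (subxx S) uS.
set B' := v |: B :\ u; set S' := v |: S :\ u => B'S'.
have vB : v \notin B by apply: contraNN vS; apply/subsetP/forces_to_sub/BS.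
have cardB' : #|B'| = #|B|.
  by rewrite cardsU1 !inE negb_and vB orbT (cardsD1 u B) uB.
have cardS' : #|S'| = #|S|.
  by rewrite cardsU1 !inE negb_and vS orbT (cardsD1 u S) uS.
have clS' : psd_closing S' := psd_closing_swap clS clW uW vW uvW.
have uS' : u \notin S'.
  by rewrite !inE eqxx orbF; apply: contraNneq uW => ->.
(* If [W] is just [v], then [u] is the only white neighbour of [v] after the exchange, and forcing
   it gains a vertex. *)
have [Wv0|/set0Pn[y yWv]] := eqVneq (W :\ v) set0.
  exists B', (u |: S'); split=> //.
  - apply: (ForcesS (u := v) B'S'); apply/standard_ruleP; split=> //; first exact: setU11.
      by rewrite adj_sym.
    move=> x vx; rewrite !inE; have [//|/= xu] := eqVneq x u.
    have [//|/= xv] := eqVneq x v; apply: contraT => xS.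
    by have := in_set0 x; rewrite -Wv0 !inE xv (clW v x vW xS vx).
  - apply: psd_closing_sub clS; apply/subsetP=> x xS; rewrite !inE xS andbT.
    by case: eqP; rewrite ?orbT.
  by rewrite cardsU1 uS' cardS'.
(* The newly white [u] touches [W] only in [v], now blue, so the component of [y] cannot leave
   [W]. *)
have CW : component (~: S') y \subset W :\ v.
  apply: component_min => // x z; rewrite !inE negb_or => /andP[xv xW].
  case/andP=> zv zS xz; rewrite zv; apply: (clW x) => //.
  move: zS; rewrite negb_and negbK => /orP[/eqP zu|//].
  by case/eqP: xv; apply/set1P; rewrite -uvW inE xW adj_sym -zu.
have yS' : y \in ~: S'.
  move: yWv; rewrite !inE negb_or => /andP[-> yW].
  by rewrite negb_and (disjointFl dSW yW) orbT.
have [|||||||B2 [S2 [cB2 f2 cl2 lt2]]] := IHm B' S' (component (~: S') y) => //.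
- apply: leq_ltn_trans (subset_leq_card CW) _.
  by move: leWm; rewrite (cardsD1 v W) vW.
- exact: component_connected.
- by apply/set0Pn; exists y; apply: component_self.
- by rewrite disjoint_sym disjoints_subset component_sub.
- move=> x z xC zS; apply: (component_closed xC); last by rewrite inE.
  exact: subsetP (component_sub yS') x xC.
by exists B2, S2; rewrite cB2 -cardS'.
Qed.

(** Each round may change the starting set but not its size, and leaves fewer white vertices. *)
Lemma forces_to_complete B S :
    ~ has_claw -> forces_to (@standard_rule G) B S -> psd_closing S ->
  exists2 B' : {set G}, #|B'| = #|B| & forces_to (@standard_rule G) B' setT.
Proof.
move=> noclaw; have [n] := ubnP #|~: S|; elim: n => // n IHn in B S *.
move=> leSn BS clS; have [ST|/set0Pn[y yS]] := eqVneq (~: S) set0.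
  by exists B => //; rewrite -setC0 -ST setCK.
have [||||B1 [S1 [cB1 f1 cl1 lt1]]] :=
  @forces_to_progress B S (component (~: S) y) noclaw BS clS.
- exact: component_connected.
- by apply/set0Pn; exists y; apply: component_self.
- by rewrite disjoint_sym disjoints_subset component_sub.
- move=> x z xC zS; apply: (component_closed xC); last by rewrite inE.
  exact: subsetP (component_sub yS) x xC.
have [|B2 cB2 f2] := IHn B1 S1 _ f1 cl1; last by exists B2; rewrite ?cB2.
have := cardsC S; have := cardsC S1; lia.
Qed.

(** * Comparison of the two forcing numbers *)

Lemma Z_le_Zplus : ~ has_claw -> Z G <= Zplus G.
Proof.
move=> noclaw; rewrite /Z /Zplus.
have [B fB <-] := forcing_number_witness (@psd_rule G).
have [B' <- fB'] :=
  forces_to_complete noclaw (Forces0 _ B) (forcing_set_psd_closing fB).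
exact/forcing_number_le/forces_to_connect.
Qed.

(** The component of [v] lies inside the white set, so a unique white neighbour is unique there as
    well. *)
Lemma valid_force_psd S u v :
  valid_force (@standard_rule G) S u v -> valid_force (@psd_rule G) S u v.
Proof.
case/and3P=> uS vS /eqP uv; rewrite /valid_force uS vS; apply/eqP/setP=> w.
apply/idP/idP; rewrite inE.
  case/andP=> /(subsetP (component_sub _)) wC uw; rewrite -uv inE wC ?uw //.
  by rewrite inE.
move/eqP->; rewrite inE component_self.
by have := set11 v; rewrite -uv inE => /andP[].
Qed.

Lemma Zplus_le_Z : Zplus G <= Z G.
Proof.
rewrite /Z; have [B fB <-] := forcing_number_witness (@standard_rule G).
apply: forcing_number_le; apply: connect_sub fB => X Y.
case/existsP=> F /and3P[/forallP vF injF defY]; apply: connect1.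
apply/existsP; exists F; rewrite injF defY !andbT; apply/forallP=> f.
apply/implyP=> fF; apply: valid_force_psd; have /implyP := vF f; exact.
Qed.

End Graph.

Lemma induced_claw (G : sgraph) (S : {set G}) :
  has_claw (induced S) -> has_claw G.
Proof.
case=> u [a [b [c [[ua ub uc] abc nadj]]]].
exists (val u), (val a), (val b), (val c).
by split; rewrite ?(map_inj_uniq val_inj).
Qed.

(** * Forcing numbers of the claw *)

Section Claw.
Variables (H : sgraph) (f : H -> complete_bipartite 1 3).
Hypotheses (bijf : bijective f) (adjf : forall x y, adj (f x) (f y) = adj x y).

(** Once the centre is blue, each leaf is a white component by itself, and the centre forces all
    leaves in a single step. *)
Lemma claw_Zplus : Zplus H <= 1.
Proof.
have [g fK gK] := bijf; pose c := g (inl ord0).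
rewrite -(cards1 c); apply: forcing_number_le; apply: connect1.
have defH x : x != c -> exists i, f x = inr i.
  case fx: (f x) => [i|i]; last by exists i.
  by rewrite -(fK x) fx ord1 eqxx.
have comp v : v != c -> component (~: [set c]) v = [set v].
  move=> vc; apply/eqP; rewrite eqEsubset sub1set component_self andbT.
  apply: component_min; first exact: set11.
  move=> x y /set1P->; rewrite !inE => yc.
  have [i fv] := defH v vc; have [j fy] := defH y yc.
  by rewrite -adjf fv fy.
have adjc v : v != c -> adj c v.
  by case/defH=> i fv; rewrite -adjf gK fv.
apply/existsP; exists [set (c, v) | v in ~: [set c]]; apply/and3P; split.
- apply/forallP=> e; apply/implyP=> /imsetP[v]; rewrite !inE => vc -> /=.
  apply/and3P; split; rewrite ?inE // /psd_rule comp //; apply/eqP/setP=> w.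
  by rewrite !inE; case: eqP => // ->; rewrite adjc.
- by apply/dinjectiveP=> e e' /imsetP[v _ ->] /imsetP[v' _ ->] /= ->.
apply/eqP/setP=> v; rewrite !inE; have [//|vc] := eqVneq v c.
apply/esym/imsetP; exists (c, v) => //.
by apply/imsetP; exists v; rewrite ?inE.
Qed.

(** A forcing set misses at most one of the three leaves, hence contains two. *)
Lemma claw_Z : 1 < Z H.
Proof.
have [g fK gK] := bijf; pose l i := g (inr i) : H.
have injl : injective l by move=> i j /(can_inj gK)[].
rewrite /Z; have [B fB <-] := forcing_number_witness (@standard_rule H).
(* Two leaves outside B are twins, so neither can ever be forced. *)
have twins i j : i != j -> l i \notin B -> l j \notin B -> False.
  move=> ij iB jB.
  have [||X [u [v [dX vW /standard_ruleP[uX vX uv sub]]]]] :=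
    @forced_into _ _ _ [set l i; l j] fB.
  - by apply/set0Pn; exists (l i); rewrite set21.
  - by rewrite disjoint_sym disjoints_subset subUset !sub1set !inE iB.
  have adjl k : adj u (l k) = adj u v.
    by case/set2P: vW => ->; rewrite -!adjf !gK; case: (f u).
  have := disjointFl dX (set21 _ _); have := disjointFl dX (set22 _ _) => jX iX.
  have := sub (l i); have := sub (l j); rewrite !adjl !inE iX jX !orbF.
  move=> /(_ uv)/eqP jv /(_ uv)/eqP iv.
  by case/eqP: ij; apply: injl; rewrite iv.
rewrite ltnNge; apply/negP=> /card_le1_eqP B1.
(* As [B] has at most one vertex, a leaf in it would leave the other two white; so no leaf is in
   [B]. *)
have out i j k : uniq [:: i; j; k] -> l i \notin B.
  rewrite /= !inE negb_or !andbT => /andP[/andP[ij ik] jk].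
  apply/negP=> iB; apply: (twins j k jk).
    by apply: contraNN ij => jB; apply/eqP/injl/B1.
  by apply: contraNN ik => kB; apply/eqP/injl/B1.
by apply: (twins ord0 ord_max) => //;
  [apply: (out _ (inord 1) ord_max)|apply: (out _ (inord 1) ord0)];
  rewrite /= !inE -!val_eqE /= !inordK.
Qed.

End Claw.

(** * Perfection and claw-freeness *)

Theorem corollary6 (G : sgraph) : perfect Zplus Z G <-> claw_free G.
Proof.
split=> [perfG S [f bijf adjf]|cfG S].
  (* The induced claw is itself an induced subgraph on which the two numbers differ. *)
  have := claw_Z bijf adjf.
  by rewrite -(perfG S) ltnNge (claw_Zplus bijf adjf).
apply/eqP; rewrite eqn_leq Zplus_le_Z Z_le_Zplus //.
by move/induced_claw; apply: claw_free_no_claw.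
Qed.
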